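(* Let $(\mathfrak{g},\pi,T)$ be an extended Rota-Baxter Lie algebra of weight $(\mu,\lambda)$ and let $(V,T_V)$ be an extended Rota-Baxter representation of it. There is a bijection between the set of isomorphism classes of abelian extensions of $(\mathfrak{g},\pi,T)$ by $(V,T_V)$ (inducing the given representation on $V$) and the second cohomology group $H^2_{\mathrm{RBA}_{(\mu,\lambda)}}(\mathfrak{g},V)$.
   Context: $\mathbf{k}$ is a field of characteristic $0$, $\mu,\lambda\in\mathbf{k}$, and $\mathbf{k}$ contains a square root of $\mu^2-4\lambda$. An extended Rota-Baxter Lie algebra of weight $(\mu,\lambda)$ is a Lie algebra $(\mathfrak{g},\pi=[-,-])$ with a linear map $T$ such that $[Ta,Tb]=T([Ta,b]+[a,Tb]+\mu[a,b])+\lambda[a,b]$; morphisms are Lie algebra morphisms commuting with the operators. An extended Rota-Baxter representation is a Lie algebra representation $(V,\rho)$, $[a,m]:=\rho(a)m$, with a linear map $T_V:V\to V$ such that $[Ta,T_Vm]=T_V([a,T_Vm]+[Ta,m]+\mu[a,m])+\lambda[a,m]$. An abelian extension of $(\mathfrak{g},\pi,T)$ by $(V,T_V)$ is a short exact sequence of morphisms of extended Rota-Baxter Lie algebras $0\to(V,T_V)\xrightarrow{i}(\hat{\mathfrak{g}},\hat T)\xrightarrow{p}(\mathfrak{g},T)\to0$ with $V$ carrying the zero bracket. Identifying $V$ with $i(V)$ and choosing a linear section $s$ of $p$, the induced representation on $V$ is $[a,m]:=[s(a),m]_{\hat{\mathfrak{g}}}$ (independent of $s$). Two abelian extensions are isomorphic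 if there is an isomorphism of extended Rota-Baxter Lie algebras $\zeta:\hat{\mathfrak{g}}_1\to\hat{\mathfrak{g}}_2$ compatible with $i_1,i_2,p_1,p_2$ and the identities of $V$ and $\mathfrak{g}$. Constants: $B_0=0$, $B_1=1$, $B_{n+1}=\mu B_n-\lambda B_{n-1}$; $A_n=\lambda B_n$ for $n\ge0$, $A_{-1}=-1$. The complex $C^*_{\mathrm{RBA}_{(\mu,\lambda)}}(\mathfrak{g},V)$: $C^n=\mathrm{Hom}(\wedge^n\mathfrak{g},V)\oplus\mathrm{Hom}(\wedge^{n-1}\mathfrak{g},V)$, $n\ge0$, with $\partial_{\mathrm{RBA}_{(\mu,\lambda)}}(f,g)=(\partial_{\mathrm{Lie}}f,\,-\partial_{\mathrm{RB}}g-\delta f)$ and cohomology $H^n_{\mathrm{RBA}_{(\mu,\lambda)}}(\mathfrak{g},V)$, where for $f\in\mathrm{Hom}(\wedge^n\mathfrak{g},V)$ $$\partial_{\mathrm{Lie}}(f)(x_1,\dots,x_{n+1})=\sum_{i}(-1)^{i+n}[x_i,f(x_1,\dots,\hat x_i,\dots,x_{n+1})]+\sum_{i<j}(-1)^{i+j+n+1}f([x_i,x_j],x_1,\dots,\hat x_i,\dots,\hat x_j,\dots,x_{n+1}),$$ $$\partial_{\mathrm{RB}}(f)(x_1,\dots,x_{n+1})=\sum_{i}(-1)^{i+n}\big([Tx_i,f(\dots\hat x_i\dots)]-T_V[x_i,f(\dots\hat x_i\dots)]\big)+\sum_{i<j}(-1)^{i+j+n+1}f([Tx_i,x_j]+[x_i,Tx_j]+\mu[x_i,x_j],x_1,\dots,\hat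 x_i,\dots,\hat x_j,\dots,x_{n+1}),$$ $$\delta(f)(x_1,\dots,x_n)=-\sum_{k=0}^n\sum_{\tau\in\mathrm{Sh}(k,n-k)}\mathrm{sgn}(\tau)A_{n-k-1}f(Tx_{\tau(1)},\dots,Tx_{\tau(k)},x_{\tau(k+1)},\dots,x_{\tau(n)})-\sum_{k=1}^n\sum_{\tau\in\mathrm{Sh}(k-1,n-k+1)}\mathrm{sgn}(\tau)B_{n-k+1}T_Vf(Tx_{\tau(1)},\dots,Tx_{\tau(k-1)},x_{\tau(k)},\dots,x_{\tau(n)}),$$ $\mathrm{Sh}(p,q)$ denoting $(p,q)$-shuffles. *)

(* Defs.v *)
From HB Require Import structures.
From mathcomp Require Import all_boot all_order all_fingroup all_algebra.
From mathcomp Require Import boolp classical_sets functions.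

Set Implicit Arguments.
Unset Strict Implicit.
Unset Printing Implicit Defensive.

Import GRing.Theory.
Local Open Scope ring_scope.

Record lieAlgebra (k : fieldType) := LieAlgebra {
  lie_sort :> lmodType k;
  lie_bracket : {bilinear lie_sort -> lie_sort -> lie_sort};
  lie_bracketxx : forall x, lie_bracket x x = 0;
  lie_jacobi : forall x y z,
    lie_bracket x (lie_bracket y z) + lie_bracket y (lie_bracket z x)
      + lie_bracket z (lie_bracket x y) = 0 }.
Arguments lie_bracket {k l}.

(* Extended Rota-Baxter Lie algebras of weight (mu, lam). *)
Record erbLie (k : fieldType) (mu lam : k) := ErbLie {
  erb_lie :> lieAlgebra k;
  erb_op : {linear erb_lie -> erb_lie};
  erb_opP : forall a b,
    lie_bracket (erb_op a) (erb_op b) =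
      erb_op (lie_bracket (erb_op a) b + lie_bracket a (erb_op b)
              + mu *: lie_bracket a b)
      + lam *: lie_bracket a b }.
Arguments erb_op {k mu lam e}.

Section Basics.
Variables (k : fieldType) (mu lam : k).
Implicit Types g h : erbLie mu lam.

Definition erb_morphism g h (phi : {linear g -> h}) : Prop :=
  (forall x y, phi (lie_bracket x y) = lie_bracket (phi x) (phi y)) /\
  (forall x, phi (erb_op x) = erb_op (phi x)).

(* The Lie algebra morphism rho : g -> gl(V) is given as the bilinear map    *)
(* rep_act a m = rho(a)(m).                                                  *)
Record erbRep g := ErbRep {
  rep_sort :> lmodType k;
  rep_act : {bilinear g -> rep_sort -> rep_sort};
  rep_act_bracket : forall a b m,
    rep_act (lie_bracket a b) m =
      rep_act a (rep_act b m) - rep_act b (rep_act a m);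
  rep_op : {linear rep_sort -> rep_sort};
  rep_opP : forall a m,
    rep_act (erb_op a) (rep_op m) =
      rep_op (rep_act a (rep_op m) + rep_act (erb_op a) m
              + mu *: rep_act a m)
      + lam *: rep_act a m }.

Section ZeroBracket.
Variables (V : lmodType k) (TV : {linear V -> V}).

Definition zero_bracket (_ _ : V) : V := 0.

Fact zero_bracket_bilinear : bilinear_for *:%R *:%R zero_bracket.
Proof. by split=> u a x y; rewrite /zero_bracket /= scaler0 addr0. Qed.

HB.instance Definition _ :=
  bilinear_isBilinear.Build k V V V *:%R *:%R zero_bracket
    zero_bracket_bilinear.

Fact zero_bracket_jacobi (x y z : V) :
  zero_bracket x (zero_bracket y z) + zero_bracket y (zero_bracket z x)
    + zero_bracket z (zero_bracket x y) = 0.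
Proof. by rewrite /zero_bracket !addr0. Qed.

Definition abelian_lie : lieAlgebra k :=
  @LieAlgebra k V zero_bracket (fun=> erefl) zero_bracket_jacobi.

Fact abelian_opP (a b : V) :
  zero_bracket (TV a) (TV b) =
    TV (zero_bracket (TV a) b + zero_bracket a (TV b)
        + mu *: zero_bracket a b)
    + lam *: zero_bracket a b.
Proof. by rewrite /zero_bracket !scaler0 !addr0 linear0. Qed.

Definition abelian_erb : erbLie mu lam :=
  @ErbLie k mu lam abelian_lie TV abelian_opP.

End ZeroBracket.

End Basics.

Arguments rep_act {k mu lam g e}.
Arguments rep_op {k mu lam g e}.

Section AbelianExtensions.
Variables (k : fieldType) (mu lam : k).
Variables (g : erbLie mu lam) (V : erbRep g).

Record abelian_ext := AbelianExt {
  ext_alg :> erbLie mu lam;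
  ext_i : {linear abelian_erb mu lam (@rep_op _ _ _ _ V) -> ext_alg};
  ext_p : {linear ext_alg -> g};
  ext_i_morphism : erb_morphism ext_i;
  ext_p_morphism : erb_morphism ext_p;
  ext_i_inj : injective ext_i;
  ext_p_surj : forall a, exists x, ext_p x = a;
  ext_exact : forall x, ext_p x = 0 <-> exists v, ext_i v = x;
  (* The representation induced by any linear section s is the given one. *)
  ext_induced : forall s : {linear g -> ext_alg}, cancel s ext_p ->
    forall (a : g) (m : V),
      ext_i (rep_act a m) = lie_bracket (s a) (ext_i m) }.

Definition ext_iso (E1 E2 : abelian_ext) : Prop :=
  exists zeta : {linear E1 -> E2},
    [/\ erb_morphism zeta, bijective zeta,
        forall v, zeta (ext_i E1 v) = ext_i E2 v
      & forall x, ext_p E2 (zeta x) = ext_p E1 x].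

(* Isomorphism classes, as predicates: universe constraints on [set] exclude *)
(* [set abelian_ext].                                                        *)
Definition ext_classes : Type :=
  {C : abelian_ext -> Prop | exists E, C = ext_iso E}.

End AbelianExtensions.

Section Cohomology.
Variables (k : fieldType) (mu lam : k).

Fixpoint Bcoef (n : nat) : k :=
  match n with
  | 0%N => 0
  | n1.+1 => match n1 with
             | 0%N => 1
             | n2.+1 => mu * Bcoef n1 - lam * Bcoef n2
             end
  end.

(* Only A_m with m >= -1 occurs. *)
Definition Acoef (m : int) : k :=
  match m with Posz n => lam * Bcoef n | Negz _ => -1 end.

(* The (p, n - p)-shuffles, for p <= n. *)
Definition shuffles (n p : nat) : {set 'S_n} :=
  [set t : 'S_n | [forall i : 'I_n, forall j : 'I_n,
     (i < j)%N && ((j < p) || (p <= i))%N ==> (t i < t j)%N]].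

Variables (g : erbLie mu lam) (V : erbRep g).

(* Arbitrary maps g^n -> V; the alternating multilinear ones, i.e. the       *)
(* elements of Hom(wedge^n g, V), are singled out by [alt_form].             *)
Definition cform (n : nat) : lmodType k := ('I_n -> g) -> V.

Definition alt_form (n : nat) : set (cform n) :=
  [set f : cform n |
    (forall (x : 'I_n -> g) (i : 'I_n),
       linear (fun a => f [eta x with i |-> a])) /\
    (forall (x : 'I_n -> g) (i j : 'I_n),
       i != j -> x i = x j -> f x = 0)].

Definition omit n (x : 'I_n.+1 -> g) (i : 'I_n.+1) : 'I_n -> g :=
  fun l => x (lift i l).

(* (b, x_0, ..., x_n) with x_i and x_j left out, for i != j. *)
Definition omit2 n (b : g) (x : 'I_n.+1 -> g) (i j : 'I_n.+1) : 'I_n -> g :=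
  fun l => nth 0
    (b :: [seq x m | m <- enum 'I_n.+1 & (m != i) && (m != j)]) l.

(* Indices start from 0 here, whence [i.+1] and [j.+1] in the signs. *)
Definition dLie n (f : cform n) : cform n.+1 := fun x =>
  \sum_(i < n.+1) (-1) ^+ (i.+1 + n) *: rep_act (x i) (f (omit x i))
  + \sum_(i < n.+1) \sum_(j < n.+1 | (i < j)%N)
      (-1) ^+ (i.+1 + j.+1 + n + 1)
        *: f (omit2 (lie_bracket (x i) (x j)) x i j).

Definition dRB n (f : cform n) : cform n.+1 := fun x =>
  \sum_(i < n.+1) (-1) ^+ (i.+1 + n) *:
    (rep_act (erb_op (x i)) (f (omit x i))
     - rep_op (rep_act (x i) (f (omit x i))))
  + \sum_(i < n.+1) \sum_(j < n.+1 | (i < j)%N)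
      (-1) ^+ (i.+1 + j.+1 + n + 1)
        *: f (omit2 (lie_bracket (erb_op (x i)) (x j)
                     + lie_bracket (x i) (erb_op (x j))
                     + mu *: lie_bracket (x i) (x j)) x i j).

(* (T x_t(1), ..., T x_t(p), x_t(p+1), ..., x_t(n)) *)
Definition op_first n (p : nat) (t : 'S_n) (x : 'I_n -> g) : 'I_n -> g :=
  fun l => if (l < p)%N then erb_op (x (t l)) else x (t l).

Definition rba_delta n (f : cform n) : cform n := fun x =>
  - (\sum_(0 <= p < n.+1) \sum_(t in shuffles n p)
       ((-1) ^+ t * Acoef (n%:Z - p%:Z - 1)) *: f (op_first p t x))
  - (\sum_(1 <= p < n.+1) \sum_(t in shuffles n p.-1)
       ((-1) ^+ t * Bcoef (n - p + 1)) *: rep_op (f (op_first p.-1 t x))).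

(* The second summand of C^0 vanishes. *)
Definition rba_form (n : nat) : lmodType k :=
  match n with
  | 0%N => cform 0
  | m.+1 => (cform m.+1 * cform m)%type
  end.

Definition rba_cochain (n : nat) : set (rba_form n) :=
  match n with
  | 0%N => @alt_form 0
  | m.+1 => [set c : cform m.+1 * cform m | alt_form c.1 /\ alt_form c.2]
  end.

Definition rba_d (n : nat) : rba_form n -> rba_form n.+1 :=
  match n with
  | 0%N => fun f => (dLie f, - rba_delta f)
  | m.+1 => fun c => (dLie c.1, - dRB c.2 - rba_delta c.1)
  end.

Definition rba_cocycle (n : nat) : set (rba_form n) :=
  [set c | rba_cochain c /\ rba_d c = 0].

Definition rba_coboundary (n : nat) : set (rba_form n) :=
  match n with
  | 0%N => [set 0]
  | m.+1 => [set rba_d c | c in @rba_cochain m]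
  end.

(* The set of cosets z + B^n with z in Z^n. *)
Definition rba_cohomology (n : nat) : Type :=
  {C : set (rba_form n) | exists2 z, @rba_cocycle n z &
     C = [set z + b | b in @rba_coboundary n]}%classic.

End Cohomology.

(* Main.v *)
(* A linear section s of an abelian extension E identifies E with g + V as a  *)
(* vector space; the bracket and the operator of E are then recorded by       *)
(* psi(a, b) = [s a, s b] - s [a, b] and chi(a) = T (s a) - s (T a), and the  *)
(* Jacobi and Rota-Baxter identities of E say exactly that (psi, chi) is a    *)
(* 2-cocycle. Changing s by a linear map g -> V changes (psi, chi) by a       *)
(* coboundary, and every 2-coboundary arises so because the degree 0 part of  *)
(* a 1-cochain can be absorbed in its degree 1 part. Sections exist by Zorn's *)
(* lemma, as g is not assumed finite-dimensional.                             *)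
From HB Require Import structures.
Require Import Defs.
From mathcomp Require Import all_boot all_order all_fingroup all_algebra.
From mathcomp Require Import boolp classical_sets functions.

Set Implicit Arguments.
Unset Strict Implicit.
Unset Printing Implicit Defensive.

Import GRing.Theory.
Local Open Scope ring_scope.

(* Decides identities of abelian groups between sums of signed atoms: the     *)
(* opposite of the leading atom is moved next to it until both cancel; the    *)
(* added 0 makes sure that every atom is followed by a sum.                   *)
Ltac zmod :=
  apply: subr0_eq;
  rewrite ?(opprD, opprK, oppr0, addr0, add0r, scalerDr, scalerN);
  rewrite -[LHS]addr0 -?addrA;
  repeat match goal with
  | |- @eq _ (Algebra.add (Algebra.opp ?x) _) _ =>
      first [rewrite (addKr x) | rewrite (addrCA _ x)]
  | |- @eq _ (Algebra.add ?x _) _ =>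
      first [rewrite (addNKr x) | rewrite (addrCA _ (- x))]
  end; by [].

Section LinearSections.
Variable k : fieldType.

Lemma linear_map_exists (U W : lmodType k) (f : U -> W) :
  linear f -> exists l : {linear U -> W}, l =1 f.
Proof.
move=> fl; pose F := GRing.isLinear.Build k U W _ f fl.
by exists (HB.pack_for {linear U -> W} f F).
Qed.

Lemma bilinear_map_exists (U U' W : lmodType k) (f : U -> U' -> W) :
  (forall u', linear (f^~ u')) -> (forall u, linear (f u)) ->
  exists l : {bilinear U -> U' -> W}, forall u, l u =1 f u.
Proof.
move=> fl fr.
pose F := bilinear_isBilinear.Build k U U' W *:%R *:%R f (conj fl fr).
by exists (HB.pack_for {bilinear U -> U' -> W} f F).
Qed.

Lemma linear_section_exists (U W : lmodType k) (p : {linear U -> W}) :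
  (forall w, exists u, p u = w) -> exists s : {linear W -> U}, cancel s p.
Proof.
move=> psurj.
pose P (S : set U) := (forall c u v, S u -> S v -> S (c *: u + v)) /\
  (forall u, S u -> p u = 0 -> u = 0).
have [|A [[Alin A0] Amax]] := @Zorn_bigcup U P.
  move=> F FP Ftot; split=> [c u v [X FX Xu] [Y FY Yv]|u [X FX Xu]]; last first.
    by have [_] := FP _ FX; apply.
  have [XY|YX] := Ftot _ _ FX FY.
    by exists Y => //; have [Ylin _] := FP _ FY; apply: Ylin => //; apply: XY.
  by exists X => //; have [Xlin _] := FP _ FX; apply: Xlin => //; apply: YX.
have A_0 : A 0.
  apply: contrapT => nA0; apply: (Amax (A `|` [set 0])%classic).
    split; first by move=> u; left.
    by move=> /(_ 0) sub; apply: nA0; apply: sub; right.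
  have Anil u : A u -> False.
    by move=> Au; apply: nA0; rewrite -(addNr u) -scaleN1r; apply: Alin.
  split=> [c u v [/Anil//|->] [/Anil//|->]|u [/Anil//|->//]].
  by right; rewrite scaler0 addr0.
have Asurj w : exists u, A u /\ p u = w.
  apply: contrapT => nw; have [u pu] := psurj w.
  apply: (Amax [set x | exists a c, A a /\ x = a + c *: u]%classic).
    split; first by move=> a Aa; exists a, 0; rewrite scale0r addr0.
    move=> /(_ u) sub; apply: nw; exists u; split=> //; apply: sub.
    by exists 0, 1; rewrite add0r scale1r.
  split=> [c _ _ [a [d [Aa ->]]] [b [e [Ab ->]]]|_ [a [c [Aa ->]]]].
    exists (c *: a + b), (c * d + e); split; first exact: Alin.
    by rewrite scalerDl scalerDr scalerA; zmod.
  have [->|c0] := eqVneq c 0; first by rewrite scale0r addr0; apply: A0.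
  rewrite linearD linearZ /= pu => /eqP; rewrite addr_eq0 => /eqP pa.
  case: nw; exists (- c^-1 *: a); split.
    by rewrite -[_ *: a]addr0; apply: Alin.
  by rewrite linearZ /= pa scaleNr scalerN opprK scalerA mulVf // scale1r.
have [s sP] := choice Asurj.
have [|l ls] := @linear_map_exists W U s; last first.
  by exists l => w; rewrite ls; case: (sP w).
have Asub u v : A u -> A v -> A (u - v).
  by move=> Au Av; rewrite addrC -scaleN1r; apply: Alin.
have [As ps] : (forall w, A (s w)) /\ (forall w, p (s w) = w).
  by split=> w; case: (sP w).
move=> c v w; apply/subr0_eq/A0; first by apply: Asub => //; apply: Alin.
by rewrite linearB linearP /= !ps subrr.
Qed.

End LinearSections.
Section LowDegreeCochains.
Variables (k : fieldType) (mu lam : k).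
Variables (g : erbLie mu lam) (V : erbRep g).
Implicit Types a b c : g.

Notation T := (@erb_op k mu lam g).
Notation TV := (@rep_op k mu lam g V).
Notation br := (@lie_bracket k _).

Definition arg0 : 'I_0 -> g := fun=> 0.
Definition arg1 a : 'I_1 -> g := fun=> a.
Definition arg2 a b : 'I_2 -> g := fun i => if i == ord0 then a else b.
Definition arg3 a b c : 'I_3 -> g := fun i => nth 0 [:: a; b; c] i.

Lemma arg0E (x : 'I_0 -> g) : x = arg0.
Proof. by apply: funext => -[]. Qed.

Lemma arg1E (x : 'I_1 -> g) : x = arg1 (x ord0).
Proof. by apply: funext => i; rewrite (ord1 i). Qed.

Lemma arg2E (x : 'I_2 -> g) : x = arg2 (x ord0) (x ord_max).
Proof.
by apply: funext => -[[|[|?]] i] //; rewrite /arg2 /=; congr x; apply: val_inj.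
Qed.

Lemma arg3E (x : 'I_3 -> g) : x = arg3 (x ord0) (x (inord 1)) (x ord_max).
Proof.
apply: funext => -[[|[|[|?]]] i] //; rewrite /arg3 /=; congr x;
  apply: val_inj => //=.
by rewrite inordK.
Qed.

Lemma big_perm2 (F : 'S_2 -> V) (P : pred 'S_2) :
  \sum_(t | P t) F t = (if P 1%g then F 1%g else 0) +
     (if P (tperm ord0 ord_max) then F (tperm ord0 ord_max) else 0).
Proof.
have t1 : tperm ord0 ord_max != 1%g :> 'S_2.
  by apply/eqP => /permP/(_ ord0); rewrite tpermL perm1.
rewrite big_mkcond (bigD1 1%g) //= (bigD1 (tperm ord0 ord_max)) //=.
rewrite big1 ?addr0 // => t /andP[tn1 tnt]; case/negP: tnt.
have t01 : t ord0 != t ord_max by rewrite (inj_eq perm_inj).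
apply/eqP/permP => i; have [t0|t0] := eqVneq (t ord0) ord0.
  case/eqP: tn1; apply/permP => -[[|[|?]] j] //; rewrite perm1.
    by rewrite (_ : Ordinal j = ord0) //; apply: val_inj.
  rewrite (_ : Ordinal j = ord_max); last exact: val_inj.
  move: t01; rewrite t0; case: (t ord_max) => -[|[|?]] h // _.
  exact: val_inj.
have {}t0 : t ord0 = ord_max.
  by move: t0; case: (t ord0) => -[|[|?]] h // _; apply: val_inj.
have t2 : t ord_max = ord0.
  move: t01; rewrite t0; case: (t ord_max) => -[|[|?]] h // _.
  exact: val_inj.
case: i => -[|[|?]] j //.
  by rewrite (_ : Ordinal j = ord0) ?tpermL //; apply: val_inj.
by rewrite (_ : Ordinal j = ord_max) ?tpermR //; apply: val_inj.
Qed.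

Lemma shuffles1 n p : (1%g : 'S_n) \in shuffles n p.
Proof.
by rewrite inE; apply/forallP=> i; apply/forallP => j; apply/implyP;
  rewrite !perm1 => /andP[].
Qed.

Lemma tperm_shuffles p :
  (tperm ord0 ord_max \in shuffles 2 p) = (p == 1).
Proof.
rewrite inE; apply/forallP/eqP => [/(_ ord0)/forallP/(_ ord_max)|-> i].
  by rewrite tpermL tpermR; case: p => [|[|p]].
apply/forallP => j; apply/implyP.
by case: i => -[|[|?]] hi //; case: j => -[|[|?]] hj.
Qed.


Lemma omit_arg1 a i : omit (arg1 a) i = arg0.
Proof. exact: arg0E. Qed.

Lemma omit_arg2 a b :
  (omit (arg2 a b) ord0 = arg1 b) * (omit (arg2 a b) ord_max = arg1 a).
Proof. by split; apply: funext => i; rewrite (ord1 i). Qed.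

Lemma ord3_inord1 : lift ord0 ord0 = inord 1 :> 'I_3.
Proof. by apply: val_inj; rewrite /= inordK. Qed.

Lemma big_ord3 (F : 'I_3 -> V) :
  \sum_(i < 3) F i = F ord0 + (F (inord 1) + F ord_max).
Proof.
rewrite !big_ord_recl big_ord0 addr0 ord3_inord1; congr (_ + (_ + F _)).
exact: val_inj.
Qed.

Lemma big_ord2 (F : 'I_2 -> V) : \sum_(i < 2) F i = F ord0 + F ord_max.
Proof.
by rewrite !big_ord_recl big_ord0 addr0; congr (_ + F _); apply: val_inj.
Qed.

Lemma big_ord2_lt (F : 'I_2 -> 'I_2 -> V) :
  \sum_(i < 2) \sum_(j < 2 | (i < j)%N) F i j = F ord0 ord_max.
Proof.
rewrite big_ord2 [X in X + _]big_mkcond [X in _ + X]big_mkcond /=.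
by rewrite !big_ord2 /= add0r !addr0.
Qed.

Lemma big_ord3_lt (F : 'I_3 -> 'I_3 -> V) :
  \sum_(i < 3) \sum_(j < 3 | (i < j)%N) F i j =
  F ord0 (inord 1) + F ord0 ord_max + F (inord 1) ord_max.
Proof.
rewrite big_ord3 [X in X + _]big_mkcond [X in _ + (X + _)]big_mkcond.
rewrite [X in _ + (_ + X)]big_mkcond /= !big_ord3 /= inordK //=.
by rewrite !add0r !addr0.
Qed.

Lemma omit_arg3 a b c :
  (omit (arg3 a b c) ord0 = arg2 b c) *
  (omit (arg3 a b c) (inord 1) = arg2 a c) *
  (omit (arg3 a b c) ord_max = arg2 a b).
Proof.
by do !split; apply: funext => -[[|[|?]] i] //; rewrite /omit /arg3 /arg2 /=
  /bump ?inordK.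
Qed.

Lemma omit2_arg2 c a b : omit2 c (arg2 a b) ord0 ord_max = arg1 c.
Proof. by apply: funext => i; rewrite (ord1 i). Qed.

Lemma omit2_arg3 d a b c :
  (omit2 d (arg3 a b c) ord0 (inord 1) = arg2 d c) *
  (omit2 d (arg3 a b c) ord0 ord_max = arg2 d b) *
  (omit2 d (arg3 a b c) (inord 1) ord_max = arg2 d a).
Proof.
by do !split; apply: funext => -[[|[|?]] i] //; rewrite /omit2
  !enum_ordSl (size0nil (size_enum_ord 0)) -?ord3_inord1 /=.
Qed.

Lemma dLie1E (f : cform V 1) a b :
  dLie f (arg2 a b) =
  rep_act a (f (arg1 b)) - rep_act b (f (arg1 a)) - f (arg1 (br a b)).
Proof.
rewrite /dLie big_ord2 !omit_arg2 big_ord2_lt omit2_arg2.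
rewrite !(exprD, exprS, expr0, mul1r, mulr1, mulN1r, opprK).
by rewrite !(scaleN1r, scale1r).
Qed.

Lemma dLie2E (f : cform V 2) a b c :
  dLie f (arg3 a b c) =
  - rep_act a (f (arg2 b c)) + rep_act b (f (arg2 a c))
    - rep_act c (f (arg2 a b))
  + f (arg2 (br a b) c) - f (arg2 (br a c) b) + f (arg2 (br b c) a).
Proof.
rewrite /dLie big_ord3_lt big_ord3 !omit_arg3 !omit2_arg3 /= inordK //.
rewrite !(exprD, exprS, expr0, mul1r, mulr1, mulN1r, opprK, scaleN1r, scale1r).
by rewrite /arg3 /= inordK //= !addrA.
Qed.

Lemma dRB0E (v : cform V 0) a :
  dRB v (arg1 a) = TV (rep_act a (v arg0)) - rep_act (T a) (v arg0).
Proof.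
rewrite /dRB !big_ord1 !omit_arg1 !big_mkcond /= !big_ord1 /=.
by rewrite expr1 scaleN1r addr0 opprB.
Qed.

Lemma dRB1E (f : cform V 1) a b :
  dRB f (arg2 a b) =
  rep_act (T a) (f (arg1 b)) - TV (rep_act a (f (arg1 b)))
  - (rep_act (T b) (f (arg1 a)) - TV (rep_act b (f (arg1 a))))
  - f (arg1 (br (T a) b + br a (T b) + mu *: br a b)).
Proof.
rewrite /dRB big_ord2 !omit_arg2 big_ord2_lt omit2_arg2.
rewrite !(exprD, exprS, expr0, mul1r, mulr1, mulN1r, opprK).
by rewrite !(scaleN1r, scale1r).
Qed.

Lemma big_perm1 (F : 'S_1 -> V) (P : pred 'S_1) :
  \sum_(t | P t) F t = if P 1%g then F 1%g else 0.
Proof.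
rewrite big_mkcond (bigD1 1%g) //= big1 ?addr0 // => t /eqP[].
by apply/permP => i; rewrite !(ord1 (_ i)) ?(ord1 i).
Qed.

Lemma op_first_1 p a :
  op_first p 1 (arg1 a) = arg1 (if (0 < p)%N then T a else a).
Proof. by apply: funext => i; rewrite /op_first (ord1 i). Qed.

Lemma op_first_2 p a b : op_first p 1 (arg2 a b) =
  arg2 (if (0 < p)%N then T a else a) (if (1 < p)%N then T b else b).
Proof. by apply: funext => -[[|[|?]] i] //; rewrite /op_first perm1. Qed.

Lemma op_first_tperm a b :
  op_first 1 (tperm ord0 ord_max) (arg2 a b) = arg2 (T b) a.
Proof.
rewrite (arg2E (op_first _ _ _)) /op_first /= tpermL tpermR.
by apply: funext => i.
Qed.

Lemma delta1E (f : cform V 1) a :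
  rba_delta f (arg1 a) = f (arg1 (T a)) - TV (f (arg1 a)).
Proof.
rewrite /rba_delta big_ltn // !big_nat1 !big_perm1 !shuffles1 /=.
rewrite odd_perm1 expr0 /= !op_first_1 /=.
by rewrite !(mul1r, mulr0) scale0r add0r scaleN1r opprK scale1r.
Qed.

Lemma delta2E (f : cform V 2) a b :
  rba_delta f (arg2 a b) = f (arg2 (T a) (T b)) - lam *: f (arg2 a b)
   - TV (mu *: f (arg2 a b) + f (arg2 (T a) b) - f (arg2 (T b) a)).
Proof.
rewrite /rba_delta big_ltn // big_ltn // !big_nat1 big_ltn // big_nat1.
rewrite !big_perm2 !shuffles1 !tperm_shuffles /=.
rewrite odd_perm1 odd_tperm expr0 /= !op_first_2 !op_first_tperm /=.
rewrite expr1 !(mul1r, mulr1, mulr0, subr0).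
rewrite !(scale0r, scaleN1r, scale1r) !(linearB TV) !(linearD TV).
rewrite (linearZ_LR TV) /=.
by zmod.
Qed.

Definition cochain2 (psi : g -> g -> V) (chi : g -> V) : rba_form V 2 :=
  ((fun x => psi (x ord0) (x ord_max)) : cform V 2,
   (fun x => chi (x ord0)) : cform V 1).

Definition cocycle2 (psi : {bilinear g -> g -> V}) (chi : {linear g -> V}) :=
  [/\ forall a, psi a a = 0,
      forall a b c, rep_act a (psi b c) + rep_act b (psi c a)
        + rep_act c (psi a b) + psi a (br b c) + psi b (br c a)
        + psi c (br a b) = 0
    & forall a b, rep_act (T a) (chi b) - rep_act (T b) (chi a)
        + psi (T a) (T b) =
      TV (rep_act a (chi b) - rep_act b (chi a) + psi (T a) b + psi a (T b)
          + mu *: psi a b)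
      + chi (br (T a) b + br a (T b) + mu *: br a b) + lam *: psi a b].

Definition dcochain1 (f : g -> V) : rba_form V 2 :=
  cochain2 (fun a b => rep_act a (f b) - rep_act b (f a) - f (br a b))
           (fun a => TV (f a) - f (T a)).

Lemma alternating_skew (psi : {bilinear g -> g -> V}) :
  (forall a, psi a a = 0) -> forall a b, psi a b = - psi b a.
Proof.
move=> psi0 a b; apply/eqP; rewrite -addr_eq0; apply/eqP.
by have := psi0 (a + b); rewrite linearDl !linearDr /= !psi0 add0r addr0.
Qed.

Lemma br_skew a b : br a b = - br b a.
Proof.
apply/eqP; rewrite -addr_eq0; apply/eqP; have := lie_bracketxx (a + b).
by rewrite linearDl !linearDr /= !lie_bracketxx add0r addr0.
Qed.

Lemma alt_form1 (f : {linear g -> V}) :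
  alt_form (fun x : 'I_1 -> g => f (x ord0) : V).
Proof.
split=> [x i c a b|x i j /eqP[]]; last by rewrite (ord1 i) (ord1 j).
by rewrite /= (ord1 i) linearP.
Qed.

Lemma alt_form2 (psi : {bilinear g -> g -> V}) : (forall a, psi a a = 0) ->
  alt_form (fun x : 'I_2 -> g => psi (x ord0) (x ord_max) : V).
Proof.
move=> psi0; split=> [x [[|[|?]] i] // c a b|x i j].
- by rewrite /= linearPl.
- by rewrite /= linearPr.
case: i => -[|[|?]] // hi; case: j => -[|[|?]] // hj _ /=.
  rewrite (_ : Ordinal hi = ord0) 1?(_ : Ordinal hj = ord_max);
  by [move=> <-; rewrite psi0|apply: val_inj].
rewrite (_ : Ordinal hi = ord_max) 1?(_ : Ordinal hj = ord0);
  by [move=> <-; rewrite psi0|apply: val_inj].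
Qed.

Lemma alt_form1_linear (f : cform V 1) : alt_form f ->
  exists l : {linear g -> V}, f = (fun x => l (x ord0)).
Proof.
move=> [flin _]; have [|l lE] := @linear_map_exists _ g V (f \o arg1).
  move=> c a b; have := flin (arg1 0) ord0 c a b.
  have E d : [eta arg1 0 with ord0 |-> d] = arg1 d :> (_ -> _).
    by rewrite [LHS]arg1E.
  by rewrite !E.
by exists l; apply: funext => x; rewrite lE /= -arg1E.
Qed.

Lemma alt_form2_bilinear (f : cform V 2) : alt_form f ->
  exists2 psi : {bilinear g -> g -> V},
    f = (fun x => psi (x ord0) (x ord_max)) & forall a, psi a a = 0.
Proof.
move=> [flin falt].
have [||l lE] := @bilinear_map_exists _ g g V (fun a b => f (arg2 a b)).
- move=> b c a a'; have := flin (arg2 0 b) ord0 c a a'.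
  have E d : [eta arg2 0 b with ord0 |-> d] = arg2 d b :> (_ -> _).
    by rewrite [LHS]arg2E.
  by rewrite !E.
- move=> a c b b'; have := flin (arg2 a 0) ord_max c b b'.
  have E d : [eta arg2 a 0 with ord_max |-> d] = arg2 a d :> (_ -> _).
    by rewrite [LHS]arg2E.
  by rewrite !E.
exists l => [|a]; first by apply: funext => x; rewrite lE /= -arg2E.
by rewrite lE; apply: (falt _ ord0 ord_max).
Qed.

Lemma dLie_cochain2 (psi : {bilinear g -> g -> V}) (chi : g -> V) a b c :
  (forall a, psi a a = 0) ->
  dLie (cochain2 psi chi).1 (arg3 a b c) =
  - (rep_act a (psi b c) + rep_act b (psi c a) + rep_act c (psi a b)
     + psi a (br b c) + psi b (br c a) + psi c (br a b)).
Proof.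
move=> psi0; rewrite dLie2E /= /arg2 /=.
rewrite (alternating_skew psi0 (br a b)) (alternating_skew psi0 (br a c)).
rewrite (alternating_skew psi0 (br b c)) (alternating_skew psi0 c a).
rewrite (br_skew c a) (linearNr psi) (linearNr rep_act).
by zmod.
Qed.

Lemma dRB_cochain2 (psi : {bilinear g -> g -> V}) (chi : {linear g -> V}) a b :
  (forall a, psi a a = 0) ->
  (- dRB (cochain2 psi chi).2 - rba_delta (cochain2 psi chi).1) (arg2 a b) =
    (TV (rep_act a (chi b) - rep_act b (chi a) + psi (T a) b + psi a (T b)
         + mu *: psi a b)
     + chi (br (T a) b + br a (T b) + mu *: br a b) + lam *: psi a b)
   - (rep_act (T a) (chi b) - rep_act (T b) (chi a) + psi (T a) (T b)).
Proof.
move=> psi0; rewrite !fctE dRB1E delta2E /= /arg2 /= /arg1.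
rewrite (alternating_skew psi0 (T b)) !(linearB TV, linearD TV, linearN TV).
by zmod.
Qed.

Lemma rba_cocycle2P z : rba_cocycle z <-> exists psi chi,
  z = cochain2 (psi : {bilinear g -> g -> V}) (chi : {linear g -> V})
    /\ cocycle2 psi chi.
Proof.
split=> [[]|[psi [chi [-> [psi0 psiJ psiT]]]]].
  case: z => z1 z2 [/= /alt_form2_bilinear[psi -> psi0]].
  move=> /alt_form1_linear[chi ->] [d1 d2]; exists psi, chi; split=> //.
  split=> // [a b c|a b].
    apply: oppr_inj; rewrite oppr0 -(dLie_cochain2 chi) //.
    by have := congr1 (fun F : cform V 3 => F (arg3 a b c)) d1.
  apply/esym/subr0_eq; rewrite -dRB_cochain2 //.
  by have := congr1 (fun F : cform V 2 => F (arg2 a b)) d2.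
split; first by split; [apply: alt_form2|apply: alt_form1].
congr pair; apply: funext => x.
  by rewrite (arg3E x) dLie_cochain2 // psiJ oppr0.
by rewrite (arg2E x) dRB_cochain2 // psiT subrr.
Qed.

Lemma rba_coboundary2P (z : rba_form V 2) :
  rba_coboundary z <-> exists f : {linear g -> V}, z = dcochain1 f.
Proof.
split=> [[[f v] [/= /alt_form1_linear[l -> _] <-]]|[f ->]].
  (* Subtracting [-, v] from f turns (f, v) into a cochain (l', 0) with the same
     differential. *)
  have [|l' lE] := @linear_map_exists _ g V (fun a => l a - rep_act a (v arg0)).
    by move=> c a a'; rewrite linearP linearPl /= scalerBr; zmod.
  exists l'; congr pair; apply: funext => x.
    rewrite {1}(arg2E x) dLie1E /= !lE rep_act_bracket.
    by rewrite !(linearBr rep_act); zmod.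
  rewrite {1}(arg1E x) !fctE dRB0E delta1E /= !lE (linearB TV).
  by zmod.
exists ((fun x => f (x ord0)) : cform V 1, 0 : cform V 0).
  split; first exact: alt_form1.
  by split=> [x []|x []].
congr pair; apply: funext => x.
  by rewrite {1}(arg2E x) dLie1E.
rewrite {1}(arg1E x) !fctE dRB0E delta1E /= linear0r linear0r linear0.
by zmod.
Qed.

End LowDegreeCochains.

Section Extensions.
Variables (k : fieldType) (mu lam : k).
Variables (g : erbLie mu lam) (V : erbRep g).
Implicit Type E : abelian_ext V.

Notation T := (@erb_op k mu lam _).
Notation TV := (@rep_op k mu lam g V).
Notation br := (@lie_bracket k _).

Definition incl E : {linear V -> E} := ext_i E.
Definition proj E : {linear E -> g} := ext_p E.

Definition realizes E (z : cform V 2 * cform V 1) :=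
  exists2 s : {linear g -> E}, cancel s (proj E) &
    (forall x, br (s (x ord0)) (s (x ord_max)) =
       s (br (x ord0) (x ord_max)) + incl E (z.1 x)) /\
    (forall x, T (s (x ord0)) = s (T (x ord0)) + incl E (z.2 x)).

Section Splitting.
Variable E : abelian_ext V.
Notation i := (incl E).
Notation p := (proj E).

Lemma incl_inj : injective i.
Proof. exact: ext_i_inj. Qed.

Lemma proj_incl v : p (i v) = 0.
Proof. by apply/(@ext_exact _ _ _ _ _ E); exists v. Qed.

Lemma kernel_incl x : p x = 0 -> exists v, i v = x.
Proof. by move/(@ext_exact _ _ _ _ _ E). Qed.

Lemma proj_br x y : p (br x y) = br (p x) (p y).
Proof. by have [] := ext_p_morphism E. Qed.

Lemma proj_op x : p (T x) = T (p x).
Proof. by have [] := ext_p_morphism E. Qed.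

Lemma op_incl v : T (i v) = i (TV v).
Proof. by have [_ ->] := ext_i_morphism E. Qed.

Lemma br_incl u v : br (i u) (i v) = 0.
Proof. by have [<- _] := ext_i_morphism E; apply: linear0. Qed.

Lemma lift_linear (U : lmodType k) (f : {linear U -> E}) :
  (forall u, p (f u) = 0) ->
  exists l : {linear U -> V}, forall u, i (l u) = f u.
Proof.
move=> pf; have [l lE] := choice (fun u => kernel_incl (pf u)).
have [|l' l'E] := @linear_map_exists _ U V l; last first.
  by exists l' => u; rewrite l'E.
by move=> c u v; apply: incl_inj; rewrite linearP !lE linearP.
Qed.

Lemma lift_bilinear (U U' : lmodType k) (f : U -> U' -> E) :
  (forall u', linear (f^~ u')) -> (forall u, linear (f u)) ->
  (forall u u', p (f u u') = 0) ->
  exists l : {bilinear U -> U' -> V}, forall u u', i (l u u') = f u u'.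
Proof.
move=> fl fr pf; pose l u u' := sval (cid (kernel_incl (pf u u'))).
have lE u u' : i (l u u') = f u u'.
  exact: (svalP (cid (kernel_incl (pf u u')))).
have [||l' l'E] := @bilinear_map_exists _ U U' V l; last 1 first.
  by exists l' => u u'; rewrite l'E.
  by move=> u' c u v; apply: incl_inj; rewrite linearP !lE fl.
by move=> u c u' v; apply: incl_inj; rewrite linearP !lE fr.
Qed.

Variables (s : {linear g -> E}) (sK : cancel s p).

Lemma br_section_incl a v : br (s a) (i v) = i (rep_act a v).
Proof. by rewrite /incl (@ext_induced _ _ _ _ _ E _ sK). Qed.

Lemma br_incl_section a v : br (i v) (s a) = - i (rep_act a v).
Proof. by rewrite br_skew br_section_incl. Qed.

Lemma section_split :
  exists r : {linear E -> V}, forall x, x = s (p x) + i (r x).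
Proof.
have [|f fE] := @linear_map_exists _ E E (fun x => x - s (p x)).
  by move=> c x y; rewrite (linearP p) (linearP s); zmod.
have [|r rE] := lift_linear (f := f).
  by move=> x; rewrite fE (linearB p) sK subrr.
by exists r => x; rewrite rE fE; zmod.
Qed.

End Splitting.

Lemma realizes_exists E :
  exists2 z : rba_form V 2, rba_cocycle z & realizes E z.
Proof.
have [s sK] := linear_section_exists (@ext_p_surj _ _ _ _ _ E).
have [|||psi psiE] := @lift_bilinear E g g
  (fun a b => br (s a) (s b) - s (br a b)).
- by move=> b c a a'; rewrite !(linearPl, linearP) /=; zmod.
- by move=> a c b b'; rewrite !(linearPr, linearP) /=; zmod.
- by move=> a b; rewrite linearB /= proj_br !sK subrr.
have [|f fE] := @linear_map_exists _ g E (fun a => T (s a) - s (T a)).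
  by move=> c a a'; rewrite !linearP /=; zmod.
have [|chi chiE] := lift_linear (f := f).
  by move=> a; rewrite fE linearB /= proj_op !sK subrr.
have brs a b : br (s a) (s b) = s (br a b) + incl E (psi a b).
  by rewrite psiE; zmod.
have Ts a : T (s a) = s (T a) + incl E (chi a) by rewrite chiE fE; zmod.
exists (cochain2 psi chi); last by exists s.
apply/rba_cocycle2P; exists psi, chi; split=> //; split=> [a|a b c|a b].
- by apply: (incl_inj (E := E)); rewrite psiE !lie_bracketxx !linear0 addr0.
- apply: (incl_inj (E := E)); rewrite linear0.
  have := lie_jacobi (s a) (s b) (s c).
  rewrite !brs !linearDr /= !brs !(br_section_incl sK) => H.
  have := congr1 s (lie_jacobi a b c); rewrite linear0 !linearD => J.
  rewrite -[RHS](subrr 0) -{1}H -J.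
  by zmod.
- pose c := br (T a) b + br a (T b) + mu *: br a b.
  pose m := rep_act a (chi b) - rep_act b (chi a) + psi (T a) b + psi a (T b)
    + mu *: psi a b.
  have argE : br (T (s a)) (s b) + br (s a) (T (s b)) + mu *: br (s a) (s b) =
      s c + incl E m.
    rewrite !Ts !(linearDl, linearDr) /= !(brs, br_incl_section sK).
    rewrite !(br_section_incl sK) !(linearD s, linearD (incl E)).
    by rewrite !(linearZ_LR s, linearZ_LR (incl E), linearN (incl E)) /=; zmod.
  have := erb_opP (s a) (s b).
  rewrite argE linearD /= op_incl (Ts c) (brs a b) => H.
  have J : s (br (T a) (T b)) = s (T c) + lam *: s (br a b).
    by rewrite erb_opP (linearD s) (linearZ_LR s).
  apply: (incl_inj (E := E)); apply: (addrI (s (br (T a) (T b)))).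
  transitivity (br (T (s a)) (T (s b))).
    rewrite !Ts !(linearDl, linearDr) /= brs br_incl (br_incl_section sK).
    rewrite (br_section_incl sK) !(linearD (incl E), linearN (incl E)).
    by zmod.
  rewrite H J -/c -/m !(linearD (incl E)) (linearZ_LR (incl E)).
  by zmod.
Qed.

Lemma cocycle_realized (z : rba_form V 2) :
  rba_cocycle z -> exists E, realizes E z.
Proof.
case/rba_cocycle2P=> psi [chi [-> [psi0 psiJ psiT]]].
pose W : lmodType k := (g * V)%type.
have [||B BE] := @bilinear_map_exists k W W W (fun x y =>
  (br x.1 y.1, rep_act x.1 y.2 - rep_act y.1 x.2 + psi x.1 y.1)).
- move=> y c x x'; congr pair; rewrite /= !(linearPl, linearP) //=.
  by zmod.
- move=> x c y y'; congr pair; rewrite /= !(linearPl, linearP) //=.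
  by zmod.
have [|O OE] := @linear_map_exists k W W (fun x => (T x.1, TV x.2 + chi x.1)).
  by move=> c x y; congr pair; rewrite /= !linearP //=; zmod.
have Bxx x : B x x = 0.
  by rewrite BE lie_bracketxx psi0; congr pair; zmod.
have BJ x y w : B x (B y w) + B y (B w x) + B w (B x y) = 0.
  rewrite !BE; congr pair; first exact: lie_jacobi.
  rewrite /= !rep_act_bracket !(linearD, linearN) /=.
  by rewrite -[RHS](psiJ x.1 y.1 w.1); zmod.
pose A : lieAlgebra k := @LieAlgebra k W B Bxx BJ.
have OP x y : B (O x) (O y) =
    O (B (O x) y + B x (O y) + mu *: B x y) + lam *: B x y.
  rewrite !BE !OE /=; congr pair; first exact: erb_opP.
  rewrite /= !(linearDr rep_act) !rep_opP.
  have -> : chi (br (T x.1) y.1 + br x.1 (T y.1) + mu *: br x.1 y.1) =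
      rep_act (T x.1) (chi y.1) - rep_act (T y.1) (chi x.1)
      + psi (T x.1) (T y.1) - lam *: psi x.1 y.1
      - TV (rep_act x.1 (chi y.1) - rep_act y.1 (chi x.1) + psi (T x.1) y.1
            + psi x.1 (T y.1) + mu *: psi x.1 y.1).
    by rewrite psiT; zmod.
  rewrite ?scalerDr ?scalerN.
  rewrite !(linearD TV, linearN TV).
  by zmod.
pose H : erbLie mu lam := @ErbLie k mu lam A O OP.
have [|i iE] := @linear_map_exists k V W (fun v => (0, v)).
  by move=> c x y; congr pair; rewrite /= scaler0 addr0.
have [|p pE] := @linear_map_exists k W g fst; first by [].
have [|s sE] := @linear_map_exists k g W (fun a => (a, 0)).
  by move=> c x y; congr pair; rewrite /= scaler0 addr0.
have iM : @erb_morphism k mu lam (abelian_erb mu lam TV) H i.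
  split=> [u v|v]; rewrite /= !iE ?BE ?OE; congr pair => /=.
  - by rewrite lie_bracketxx.
  - by rewrite !linear0l addr0 subrr.
  - by rewrite linear0.
  - by rewrite linear0 addr0.
have pM : @erb_morphism k mu lam H g p.
  by split=> [x y|x]; rewrite /= !pE ?BE ?OE.
have iI : injective i by move=> u v; rewrite !iE => -[].
have pS a : exists x, p x = a by exists (a, 0); rewrite pE.
have ex x : p x = 0 <-> exists v, i v = x.
  rewrite pE; split=> [x0|[v <-]]; last by rewrite iE.
  by exists x.2; rewrite iE -x0; case: (x).
have ind (t : {linear g -> H}) : cancel t p -> forall a m,
    i (rep_act a m) = B (t a) (i m).
  move=> tK a m; rewrite BE !iE /=; have := tK a; rewrite pE => ->.
  congr pair; first by rewrite linear0r.
  by rewrite !(linear0l, linear0r); zmod.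
exists (@AbelianExt k mu lam g V H i p iM pM iI pS ex ind), s.
  by move=> a; rewrite /proj /= pE sE.
split=> x; rewrite /incl /= !iE !sE ?BE ?OE; congr pair => /=.
- by rewrite addr0.
- by rewrite !linear0r; zmod.
- by rewrite addr0.
- by rewrite linear0.
Qed.

Lemma realizes_coboundary E (z1 z2 : rba_form V 2) :
  realizes E z1 -> realizes E z2 -> rba_coboundary (z1 - z2).
Proof.
move=> [s sK [s1 s2]] [t tK [t1 t2]].
have [|f fE] := @linear_map_exists k g E (fun a => s a - t a).
  by move=> c a b; rewrite (linearP s) (linearP t); zmod.
have [|l lE] := lift_linear (f := f).
  by move=> a; rewrite fE linearB sK tK subrr.
have {f fE} lE a : incl E (l a) = s a - t a.
  by rewrite lE fE.
have sE a : s a = t a + incl E (l a) by rewrite lE; zmod.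
apply/rba_coboundary2P; exists l; congr pair; apply: funext => x /=;
  apply: (incl_inj (E := E)); rewrite !fctE /=.
- have := s1 x; rewrite !sE linearDl !linearDr /= t1 br_incl.
  rewrite (br_section_incl tK) (br_incl_section tK).
  move/esym/(canRL (addKr _)); rewrite !(linearD (incl E), linearN (incl E)).
  by move->; zmod.
- have := s2 x; rewrite !sE linearD /= t2 op_incl.
  move/esym/(canRL (addKr _)); rewrite !(linearD (incl E), linearN (incl E)).
  by move->; zmod.
Qed.

Lemma realizes_addr E (z b : rba_form V 2) :
  realizes E z -> rba_coboundary b -> realizes E (z + b).
Proof.
move=> [s sK [s1 s2]] /rba_coboundary2P[l ->].
have [|t tE] := @linear_map_exists k g E (fun a => s a + incl E (l a)).
  by move=> c a b'; rewrite !linearP; zmod.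
exists t.
  by move=> a; rewrite tE (linearD (proj E)) /= proj_incl addr0 sK.
split=> x; rewrite !tE /=.
  rewrite linearDl !linearDr /= s1 br_incl (br_section_incl sK).
  rewrite (br_incl_section sK) !(linearD (incl E), linearN (incl E)) /=.
  by zmod.
by rewrite linearD /= s2 op_incl !(linearD (incl E), linearN (incl E)); zmod.
Qed.

Lemma realizes_iso E1 E2 (z : rba_form V 2) :
  ext_iso E1 E2 -> realizes E1 z -> realizes E2 z.
Proof.
move=> [zeta [[zbr zop] _ zi zp]] [s sK [s1 s2]].
have [|t tE] := @linear_map_exists k g E2 (fun a => zeta (s a)).
  by move=> c a b; rewrite !linearP.
exists t; first by move=> a; rewrite tE /proj zp; apply: sK.
split=> x; rewrite !tE.
  by rewrite -zbr s1 linearD /incl zi.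
by rewrite -zop s2 linearD /incl zi.
Qed.

Lemma realizes_ext_iso E1 E2 (z : rba_form V 2) :
  realizes E1 z -> realizes E2 z -> ext_iso E1 E2.
Proof.
move=> [s sK [s1 s2]] [t tK [t1 t2]].
have [r rE] := section_split sK; have [q qE] := section_split tK.
have rD a v : r (s a + incl E1 v) = v.
  apply: (incl_inj (E := E1)); have := rE (s a + incl E1 v).
  by rewrite (linearD (proj E1)) proj_incl sK addr0 => /addrI.
have qD a v : q (t a + incl E2 v) = v.
  apply: (incl_inj (E := E2)); have := qE (t a + incl E2 v).
  by rewrite (linearD (proj E2)) proj_incl tK addr0 => /addrI.
have [|zeta zetaE] := @linear_map_exists k E1 E2
    (fun x => t (proj E1 x) + incl E2 (r x)).
  by move=> c x y; rewrite !linearP; zmod.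
have zetaD a v : zeta (s a + incl E1 v) = t a + incl E2 v.
  by rewrite zetaE rD (linearD (proj E1)) proj_incl sK addr0.
have zetas a : zeta (s a) = t a.
  by have := zetaD a 0; rewrite !linear0 !addr0.
have zetai v : zeta (incl E1 v) = incl E2 v.
  by have := zetaD 0 v; rewrite !linear0 !add0r.
exists zeta; split.
- split=> [x y|x].
    rewrite (rE x) (rE y) !zetaD.
    move: (proj E1 x) (proj E1 y) (r x) (r y) => a b u v.
    rewrite !linearDl !linearDr /= !br_incl (br_section_incl sK).
    rewrite (br_section_incl tK) (br_incl_section sK) (br_incl_section tK).
    have /= -> := s1 (arg2 a b); have /= -> := t1 (arg2 a b).
    by rewrite /arg2 /= !(linearD zeta) linear0 linearN zetas !zetai.
  rewrite (rE x) !zetaD; move: (proj E1 x) (r x) => a u.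
  rewrite !linearD /= !op_incl.
  have /= -> := s2 (arg1 a); have /= -> := t2 (arg1 a).
  by rewrite /arg1 !(linearD zeta) zetas !zetai.
- exists (fun y => s (proj E2 y) + incl E1 (q y)) => x.
    by rewrite (rE x) zetaD qD (linearD (proj E2)) proj_incl tK addr0.
  by rewrite zetaD -qE.
- exact: zetai.
- move=> x; rewrite -[ext_p E2]/(proj E2) {1}(rE x) zetaD.
  by rewrite (linearD (proj E2)) proj_incl tK addr0.
Qed.

Lemma ext_isoP E1 E2 (z1 z2 : rba_form V 2) :
  realizes E1 z1 -> realizes E2 z2 ->
  ext_iso E1 E2 <-> rba_coboundary (z1 - z2).
Proof.
move=> r1 r2; split=> [iso12|cob].
  by apply: realizes_coboundary r2; apply: realizes_iso r1.
apply: realizes_ext_iso r1 _.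
by have := realizes_addr r2 cob; rewrite addrC subrK.
Qed.

Lemma rba_coboundaryB (b1 b2 : rba_form V 2) :
  rba_coboundary b1 -> rba_coboundary b2 -> rba_coboundary (b1 - b2).
Proof.
move=> /rba_coboundary2P[f1 ->] /rba_coboundary2P[f2 ->].
have [|f fE] := @linear_map_exists k g V (fun a => f1 a - f2 a).
  by move=> c a b; rewrite (linearP f1) (linearP f2); zmod.
apply/rba_coboundary2P; exists f; congr pair; apply: funext => x.
  rewrite -[LHS]/((dcochain1 f1).1 x - (dcochain1 f2).1 x) /= !fE.
  by rewrite !(linearBr rep_act); zmod.
rewrite -[LHS]/((dcochain1 f1).2 x - (dcochain1 f2).2 x) /= !fE (linearB TV).
by zmod.
Qed.

Lemma rba_coboundary0 : rba_coboundary (0 : rba_form V 2).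
Proof.
have [|f fE] := @linear_map_exists k g V (fun=> 0).
  by move=> c a b; rewrite scaler0 addr0.
have cf : rba_coboundary (dcochain1 f) by apply/rba_coboundary2P; exists f.
by have := rba_coboundaryB cf cf; rewrite subrr.
Qed.

Definition coset2 (z : rba_form V 2) : set (rba_form V 2) :=
  [set z + b | b in @rba_coboundary k mu lam g V 2]%classic.

Lemma coset2_eq (z1 z2 : rba_form V 2) :
  coset2 z1 = coset2 z2 <-> rba_coboundary (z1 - z2).
Proof.
split=> [eq12|cob].
  have [b cb <-] : coset2 z2 z1.
    by rewrite -eq12; exists 0; [apply: rba_coboundary0|rewrite addr0].
  by rewrite addrC addKr.
have sub u v : rba_coboundary (u - v) -> (coset2 u `<=` coset2 v)%classic.
  move=> cuv _ [b cb <-]; exists (u - v - (0 - b)).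
    by do 2!apply: rba_coboundaryB => //; apply: rba_coboundary0.
  by zmod.
apply/seteqP; split; apply: sub => //.
by rewrite -opprB -sub0r; apply: rba_coboundaryB => //; apply: rba_coboundary0.
Qed.

End Extensions.

Theorem proposition8p10 (k : fieldType) (mu lam : k)
    (char0 : [pchar k] =i pred0)
    (sqrt_disc : exists r : k, r ^+ 2 = mu ^+ 2 - 4 * lam)
    (g : erbLie mu lam) (V : erbRep g) :
  exists Phi : ext_classes V -> rba_cohomology V 2%N, bijective Phi.
Proof.
have sval_inj (A : Type) (P : A -> Prop) (u v : {x | P x}) :
    sval u = sval v -> u = v.
  case: u v => [x Px] [y Py] /= exy; subst y; congr exist.
  exact: Prop_irrelevance.
pose ext (C : ext_classes V) := sval (cid (svalP C)).
have extE C : sval C = ext_iso (ext C) by exact: svalP (cid (svalP C)).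
have [z zP] : {z : ext_classes V -> rba_form V 2 |
    forall C, rba_cocycle (z C) /\ realizes (ext C) (z C)}.
  by apply: cid; have [] := choice (fun C => let: ex_intro2 z c r :=
     realizes_exists (ext C) in ex_intro _ z (conj c r)) => z ?; exists z.
have cosetP C : exists2 w : rba_form V 2, rba_cocycle w & coset2 (z C) =
    [set w + b | b in @rba_coboundary k mu lam g V 2]%classic.
  by exists (z C) => //; case: (zP C).
pose Phi C : rba_cohomology V 2 := exist _ (coset2 (z C)) (cosetP C).
have PhiI : injective Phi.
  move=> C1 C2 /(congr1 sval) /= /coset2_eq cob; apply: sval_inj.
  rewrite !extE; apply: funext => E; apply: propext.
  have [w _ rw] := realizes_exists E.
  have [_ r1] := zP C1; have [_ r2] := zP C2.
  rewrite (ext_isoP r1 rw) (ext_isoP r2 rw) -!coset2_eq.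
  by move/coset2_eq: cob => ->.
have PhiS D : exists C, Phi C = D.
  have [w cw Dw] := svalP D; have [E rE] := cocycle_realized cw.
  have C0 : exists E', ext_iso E = ext_iso E' by exists E.
  pose C : ext_classes V := exist _ (ext_iso E) C0.
  exists C; apply: sval_inj; rewrite Dw; apply/coset2_eq.
  have [_ rC] := zP C; apply/(ext_isoP rC rE).
  rewrite -extE /=; apply/(ext_isoP rE rE).
  by rewrite subrr; apply: rba_coboundary0.
exists Phi; have [Psi PsiK] := choice PhiS; exists Psi => // C.
by apply: PhiI; rewrite PsiK.
Qed.
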